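(* A ternary form $f$ over $\mathbb{C}$ of degree at most 4 has Clebsch covariant $S(f)$ identically zero if and only if $f$ lies in the closure of the set of ternary forms (of the same degree) which can be written as $\alpha(x,y)+\beta(z)$ in some linear coordinates $(x,y,z)$.
   Context: For a ternary form $f(x_1,x_2,x_3)$ write $f_{ijk}=\partial^3 f/\partial x_i\partial x_j\partial x_k$ and set $a_3=f_{333}$, $a_2=f_{133}$, $b_2=f_{233}$, $a_1=f_{113}$, $b_1=f_{123}$, $c_1=f_{223}$, $a_0=f_{111}$, $b_0=f_{112}$, $c_0=f_{122}$, $d_0=f_{222}$. The Clebsch covariant is the polynomial $S(f)=-(a_0a_2-a_1^2)c_1^2+(a_0a_3-a_1a_2)c_0c_1-(a_1a_3-a_2^2)c_0^2-b_0^2a_3c_1+b_0b_1(3a_2c_1+a_3c_0)-(b_0b_2+2b_1^2)(a_1c_1+a_2c_0)+b_1b_2(a_0c_1+3a_1c_0)-b_2^2a_0c_0+d_0[b_0(a_1a_3-a_2^2)-b_1(a_0a_3-a_1a_2)+b_2(a_0a_2-a_1^2)]+(b_0b_2-b_1^2)^2.$ ''In some linear coordinates'' means after a change of variables by an element of $GL(3,\mathbb{C})$. *)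

(* Defs.v *)
From HB Require Import structures.
From mathcomp Require Import all_boot all_order all_algebra.
From mathcomp Require Import reals.
From mathcomp Require Import complex.
From mathcomp Require Import mpoly.
Set Implicit Arguments. Unset Strict Implicit. Unset Printing Implicit Defensive.
Import Order.TTheory GRing.Theory Num.Theory.
Local Open Scope ring_scope.

Section Clebsch.
Variable C : fieldType.

Definition v1 : 'I_3 := inord 0.
Definition v2 : 'I_3 := inord 1.
Definition v3 : 'I_3 := inord 2.

Definition d3 (f : {mpoly C[3]}) (i j k : 'I_3) : {mpoly C[3]} :=
  mderiv i (mderiv j (mderiv k f)).

Definition clebsch (f : {mpoly C[3]}) : {mpoly C[3]} :=
  let a3 := d3 f v3 v3 v3 in let a2 := d3 f v1 v3 v3 in
  let b2 := d3 f v2 v3 v3 in let a1 := d3 f v1 v1 v3 in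
  let b1 := d3 f v1 v2 v3 in let c1 := d3 f v2 v2 v3 in
  let a0 := d3 f v1 v1 v1 in let b0 := d3 f v1 v1 v2 in
  let c0 := d3 f v1 v2 v2 in let d0 := d3 f v2 v2 v2 in
  - (a0 * a2 - a1 ^+ 2) * c1 ^+ 2 + (a0 * a3 - a1 * a2) * c0 * c1
  - (a1 * a3 - a2 ^+ 2) * c0 ^+ 2 - b0 ^+ 2 * a3 * c1
  + b0 * b1 * (3%:R * a2 * c1 + a3 * c0)
  - (b0 * b2 + 2%:R * b1 ^+ 2) * (a1 * c1 + a2 * c0)
  + b1 * b2 * (a0 * c1 + 3%:R * a1 * c0) - b2 ^+ 2 * a0 * c0
  + d0 * (b0 * (a1 * a3 - a2 ^+ 2) - b1 * (a0 * a3 - a1 * a2)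
          + b2 * (a0 * a2 - a1 ^+ 2))
  + (b0 * b2 - b1 ^+ 2) ^+ 2.

Definition lin_change (A : 'M[C]_3) (g : {mpoly C[3]}) : {mpoly C[3]} :=
  g \mPo [tuple \sum_(j < 3) A i j *: 'X_j | i < 3].

Definition split_std (d : nat) (g : {mpoly C[3]}) : Prop :=
  exists (alpha : {mpoly C[2]}) (c : C),
    alpha \is d.-homog /\
    g = alpha \mPo [tuple 'X_v1; 'X_v2] + c *: 'X_v3 ^+ d.

Definition split_form (d : nat) (f : {mpoly C[3]}) : Prop :=
  exists (A : 'M[C]_3) (g : {mpoly C[3]}),
    A \in unitmx /\ split_std d g /\ f = lin_change A g.
End Clebsch.

(* closure (Euclidean topology on the finite-dimensional coefficient space)
   of the set of degree-d forms of split shape *)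
Definition in_split_closure (R : realType) (d : nat) (f : {mpoly R[i][3]}) : Prop :=
  forall eps : R, 0 < eps ->
    exists g : {mpoly R[i][3]}, split_form d g /\
      forall m : 'X_{1..3}, `|f@_m - g@_m| < (eps%:C)%C.

(* Main.v *)
(* Let F(x, u, v, w) be the derivatives D_x D_u D_v D_w f of a quartic f, and
   for a cubic drop x. By covariance, S(f) = 0 says that the Clebsch expression
   of u, v, w |-> F(x, u, v, w) vanishes in every basis u, v, w.

   If D_v D_w kills the cubic F(x, ., ., .) and e completes v, w to a basis, the
   Clebsch expression is the product of the two 2x2 determinants describing the
   binary quadratic forms D_v F(x, ...) and D_w F(x, ...), so one of these two
   has rank at most 1. A pair v, w always exists, as a pencil of quadrics has a
   singular member. So a cubic with S = 0 has a polar conic D_v f of the form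
   c l^2.

   For a quartic fix p and take v with D_p D_v f = c l^2. For all k in the plane
   l = 0 we get D_p D_v D_k f = 0, so either all D_k D_p f or all D_k D_v f have
   rank at most 1. A linear space of quadrics of rank at most 1 has dimension at
   most 1, so some such k is sent to 0: there are p1, p2 with D_p1 D_p2 f = 0.
   Applying the factorization to all polars of f, one of D_p1 f, D_p2 f has all
   its polars of rank at most 1, i.e. is c l^3.

   Thus S(f) = 0 yields v with D_v f = c l^(d-1). If l(v) <> 0 then f is of the
   form alpha(x, y) + beta(z); otherwise f = alpha + c z l^(d-1) with
   D_v alpha = 0, and z l^(d-1) is the limit of ((l + t z)^d - l^d) / (d t). *)
Require Import Defs.
From HB Require Import structures.
From mathcomp Require Import all_boot all_order all_algebra.
From mathcomp Require Import reals complex mpoly.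
From mathcomp Require Import spectral ring boolp.
Import Order.TTheory GRing.Theory Num.Theory.
Local Open Scope ring_scope.
Set Implicit Arguments. Unset Strict Implicit.
Unset Printing Implicit Defensive.

(** * The Clebsch expression of a trilinear form *)

(** Aronhold's invariant of degree 4 of a ternary cubic, as a polynomial in its ten third
    derivatives. *)
Definition aronhold (K : comNzRingType)
    (a0 a1 a2 a3 b0 b1 b2 c0 c1 d0 : K) : K :=
  - (a0 * a2 - a1 ^+ 2) * c1 ^+ 2 + (a0 * a3 - a1 * a2) * c0 * c1
  - (a1 * a3 - a2 ^+ 2) * c0 ^+ 2 - b0 ^+ 2 * a3 * c1
  + b0 * b1 * (3%:R * a2 * c1 + a3 * c0)
  - (b0 * b2 + 2%:R * b1 ^+ 2) * (a1 * c1 + a2 * c0)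
  + b1 * b2 * (a0 * c1 + 3%:R * a1 * c0) - b2 ^+ 2 * a0 * c0
  + d0 * (b0 * (a1 * a3 - a2 ^+ 2) - b1 * (a0 * a3 - a1 * a2)
          + b2 * (a0 * a2 - a1 ^+ 2))
  + (b0 * b2 - b1 ^+ 2) ^+ 2.

(** Scalars enter through [io] so that polynomial-valued third derivatives ([io] the embedding of
    constants) and their values at a point ([io] the identity) share one theory. *)
Definition trilinear_sym (C : nzRingType) (K : comNzRingType) (io : C -> K)
    (T : 'rV[C]_3 -> 'rV[C]_3 -> 'rV[C]_3 -> K) : Prop :=
  [/\ forall u v w, T u v w = T v u w, forall u v w, T u v w = T u w v
    & forall a u u' v w, T (a *: u + u') v w = io a * T u v w + T u' v w].

Definition clebsch_at (C : nzRingType) (K : comNzRingType)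
    (T : 'rV[C]_3 -> 'rV[C]_3 -> 'rV[C]_3 -> K) (u v w : 'rV[C]_3) : K :=
  aronhold (T u u u) (T u u w) (T u w w) (T w w w) (T u u v) (T u v w)
           (T v w w) (T u v v) (T v v w) (T v v v).

Section Trilinear.
Variables (C : fieldType) (K : comNzRingType) (io : {rmorphism C -> K}).
Variable T : 'rV[C]_3 -> 'rV[C]_3 -> 'rV[C]_3 -> K.
Hypothesis triT : trilinear_sym io T.
Implicit Types (u v w x y z : 'rV[C]_3) (a b c : C).

Lemma tri0 v w : T 0 v w = 0.
Proof.
case: triT => _ _ lin; have := lin (-1) 0 0 v w.
by rewrite scaler0 addr0 rmorphN1 mulN1r addNr.
Qed.

Lemma tri_lin1 a b c u v w x y :
  T (a *: u + b *: v + c *: w) x y =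
  io a * T u x y + io b * T v x y + io c * T w x y.
Proof.
case: triT => _ _ lin; rewrite -addrA !lin -[c *: w]addr0 lin tri0.
by rewrite addr0 addrA.
Qed.

Lemma tri_lin2 a b c u v w x y :
  T x (a *: u + b *: v + c *: w) y =
  io a * T x u y + io b * T x v y + io c * T x w y.
Proof. by case: triT => s _ _; rewrite s tri_lin1 !(s x). Qed.

Lemma tri_lin3 a b c u v w x y :
  T x y (a *: u + b *: v + c *: w) =
  io a * T x y u + io b * T x y v + io c * T x y w.
Proof. by case: triT => _ s _; rewrite s tri_lin2 !(s x y). Qed.

(** Sorts the arguments, so that [ring] sees only the ten coefficients. *)
Lemma tri_symE u v w :
  ((T v u u = T u u v) * (T u v u = T u u v) *
   (T v v u = T u v v) * (T v u v = T u v v) *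
   (T w u u = T u u w) * (T u w u = T u u w) *
   (T w w u = T u w w) * (T w u w = T u w w) *
   (T w v v = T v v w) * (T v w v = T v v w) *
   (T w w v = T v w w) * (T w v w = T v w w) *
   (T u w v = T u v w) * (T v w u = T u v w) * (T v u w = T u v w) *
   (T w v u = T u v w) * (T w u v = T u v w))%type.
Proof.
case: triT => s1 s2 _; do !split;
  first [exact: s1 | exact: s2 | by rewrite s1 s2 | by rewrite s2 s1
        | by rewrite s1 s2 s1].
Qed.

Lemma clebsch_at_swap12 u v w : clebsch_at T u v w = clebsch_at T v u w.
Proof. by rewrite /clebsch_at !(tri_symE u v w) /aronhold; ring. Qed.

Lemma clebsch_at_swap13 u v w : clebsch_at T u v w = clebsch_at T w v u.
Proof. by rewrite /clebsch_at !(tri_symE u v w) /aronhold; ring. Qed.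

(** Invariance of weight 4: this change fixes the last vector, so its determinant is
    [a * b' - a' * b]. Combined with the two swaps, such changes connect all bases. *)
Lemma clebsch_at_change a b c a' b' c' u v w :
  clebsch_at T (a *: u + b *: v + c *: w) (a' *: u + b' *: v + c' *: w) w =
  io (a * b' - a' * b) ^+ 4 * clebsch_at T u v w.
Proof.
rewrite /clebsch_at !tri_lin1 !tri_lin2 !tri_lin3 !(tri_symE u v w).
rewrite rmorphB !rmorphM /aronhold.
ring.
Qed.

Definition spans u v w := forall x, exists a b c, x = a *: u + b *: v + c *: w.

(** First z replaces w, which costs a factor [c ^+ 4]; then x and y are expanded in the basis u, v,
    z. *)
Lemma clebsch_at_last u v w x y z a b c :
  spans u v w -> c != 0 -> z = a *: u + b *: v + c *: w ->
  clebsch_at T u v w = 0 -> clebsch_at T x y z = 0.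
Proof.
move=> uvw c0 zE S0.
have spz p : exists a' b' c', p = a' *: u + b' *: v + c' *: z.
  have [p1 [p2 [p3 ->]]] := uvw p.
  exists (p1 - p3 / c * a), (p2 - p3 / c * b), (p3 / c).
  by apply/rowP=> i; rewrite zE !mxE; field.
have [x1 [x2 [x3 ->]]] := spz x; have [y1 [y2 [y3 ->]]] := spz y.
rewrite clebsch_at_change zE clebsch_at_swap13.
have -> : a *: u + b *: v + c *: w = c *: w + b *: v + a *: u.
  by rewrite addrC [_ + b *: v]addrC addrA.
have := clebsch_at_change c b a 0 1 0 w v u.
rewrite scale0r scale1r add0r scale0r addr0 => ->.
by rewrite clebsch_at_swap13 S0 !mulr0.
Qed.

Lemma clebsch_at_eq0 u v w : spans u v w -> clebsch_at T u v w = 0 ->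
  forall x y z, clebsch_at T x y z = 0.
Proof.
move=> uvw S0 x y z; have [a [b [c zE]]] := uvw z.
have [c0|/clebsch_at_last] := eqVneq c 0; last by apply; eauto.
have [b0|b0] := eqVneq b 0; last first.
  apply: (@clebsch_at_last u w v _ _ _ a c b) => //.
  - move=> p; have [p1 [p2 [p3 ->]]] := uvw p.
    by exists p1, p3, p2; rewrite addrAC.
  - by rewrite addrAC.
  by rewrite clebsch_at_swap13 clebsch_at_swap12 clebsch_at_swap13.
have [a0|a0] := eqVneq a 0; last first.
  apply: (@clebsch_at_last w v u _ _ _ c b a) => //.
  - move=> p; have [p1 [p2 [p3 ->]]] := uvw p; exists p3, p2, p1.
    by apply/rowP=> i; rewrite !mxE; ring.
  - by apply/rowP=> i; rewrite zE !mxE; ring.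
  by rewrite clebsch_at_swap13.
(* Only z = 0 is left; as a zero row in the change of basis it makes the determinant vanish. *)
rewrite zE a0 b0 c0 clebsch_at_swap13 !scale0r !addr0.
have := clebsch_at_change 0 0 0 0 1 0 0 y x.
rewrite !scale0r scale1r !add0r !addr0 => ->.
by rewrite !mul0r subrr rmorph0 expr0n mul0r.
Qed.
End Trilinear.

(** * Cubics and quartics as symmetric multilinear forms *)

Definition lform (C : nzRingType) (l : 'rV[C]_3 -> C) : Prop :=
  forall a u v, l (a *: u + v) = a * l u + l v.

(** For a symmetric form over a field where 2 is invertible, these minors recover all 2x2 minors by
    polarization. *)
Definition rank_le1 (C : nzRingType) (q : 'rV[C]_3 -> 'rV[C]_3 -> C) : Prop :=
  forall x y, q x x * q y y = q x y ^+ 2.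

Section Field3.
Variable C : fieldType.
Implicit Types (u v w x y z e : 'rV[C]_3) (a b c : C).

Lemma ord3P (P : 'I_3 -> Prop) : P 0 -> P 1 -> P 2%:R -> forall i, P i.
Proof.
by move=> P0 P1 P2 [[|[|[|//]]] Hi]; [move: P0|move: P1|move: P2];
  congr P; apply/val_inj.
Qed.

Lemma sum_ord3 (K : nmodType) (F : 'I_3 -> K) :
  \sum_i F i = F 0 + F 1 + F 2%:R.
Proof.
by rewrite !big_ord_recl big_ord0 addr0 addrA;
  congr (F _ + F _ + F _); exact/val_inj.
Qed.

Lemma row3E x : x = x 0 0 *: delta_mx 0 0 + x 0 1 *: delta_mx 0 1
                    + x 0 2%:R *: delta_mx 0 2%:R.
Proof.
by apply/rowP; apply: ord3P; rewrite !mxE /=; ring.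
Qed.

Lemma spans_delta :
  spans (delta_mx 0 0 : 'rV[C]_3) (delta_mx 0 1) (delta_mx 0 2%:R).
Proof. by move=> x; exists (x 0 0), (x 0 1), (x 0 2%:R); exact: row3E. Qed.

Lemma spans_last v : v != 0 -> exists e e', spans e e' v.
Proof.
case/rV0Pn; apply: ord3P => vi; [exists (delta_mx 0 1), (delta_mx 0 2%:R)
  | exists (delta_mx 0 0), (delta_mx 0 2%:R)
  | exists (delta_mx 0 0), (delta_mx 0 1)] => x;
  [pose c := x 0 0 / v 0 0 | pose c := x 0 1 / v 0 1
  | pose c := x 0 2%:R / v 0 2%:R];
  [exists (x 0 1 - c * v 0 1), (x 0 2%:R - c * v 0 2%:R)
  | exists (x 0 0 - c * v 0 0), (x 0 2%:R - c * v 0 2%:R)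
  | exists (x 0 0 - c * v 0 0), (x 0 1 - c * v 0 1)]; exists c;
  by apply/rowP; apply: ord3P; rewrite !mxE /= /c; field.
Qed.

Lemma collinear_or_spans v w :
  v != 0 -> (exists c, w = c *: v) \/ exists e, spans v e w.
Proof.
move=> /spans_last[e [e' sp]]; have [a [b [c wE]]] := sp w.
have [a0|a0] := eqVneq a 0; last first.
  right; exists e' => x; have [p [q [r ->]]] := sp x.
  exists (r - p / a * c), (q - p / a * b), (p / a).
  by apply/rowP=> i; rewrite wE !mxE; field.
have [b0|b0] := eqVneq b 0; last first.
  right; exists e => x; have [p [q [r ->]]] := sp x.
  exists (r - q / b * c), (p - q / b * a), (q / b).
  by apply/rowP=> i; rewrite wE !mxE; field.
by left; exists c; rewrite wE a0 b0 !scale0r !add0r.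
Qed.

Lemma lform_delta (l : 'rV[C]_3 -> C) x : lform l ->
  l x = x 0 0 * l (delta_mx 0 0) + x 0 1 * l (delta_mx 0 1)
        + x 0 2%:R * l (delta_mx 0 2%:R).
Proof.
move=> lL; have l0 : l 0 = 0.
  by have := lL (-1) 0 0; rewrite scaler0 addr0 mulN1r addNr.
by rewrite {1}(row3E x) -addrA !lL -[_ *: _]addr0 lL l0 addr0 addrA.
Qed.

(** A 3 by 2 matrix has a nonzero left kernel. *)
Lemma common_zero (l m : 'rV[C]_3 -> C) : lform l -> lform m ->
  exists2 k, k != 0 & l k = 0 /\ m k = 0.
Proof.
move=> lL mL.
pose A : 'M[C]_(3, 2) := \matrix_(i, j)
  (if j == 0 then l (delta_mx 0 i) else m (delta_mx 0 i)).
have : kermx A != 0.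
  rewrite kermx_eq0; apply/negP => /eqP rkA.
  by have := rank_leq_col A; rewrite rkA.
case/rowV0Pn => k /sub_kermxP kA k0; exists k => //.
split; rewrite lform_delta //.
  by have /rowP/(_ 0) := kA; rewrite !mxE sum_ord3 !mxE /=.
by have /rowP/(_ 1) := kA; rewrite !mxE sum_ord3 !mxE /=.
Qed.

End Field3.

(** * Polars of rank one of cubics and quartics *)

Section RankOne.
Variable C : numClosedFieldType.
Implicit Types (T : 'rV[C]_3 -> 'rV[C]_3 -> 'rV[C]_3 -> C).
Implicit Types (u v w x y z e k p : 'rV[C]_3) (a b c : C).

Lemma horner_eq0_all (q : {poly C}) : (forall t, q.[t] = 0) -> q = 0.
Proof.
move=> q0; apply: (@roots_geq_poly_eq0 _ _ (mkseq (fun i => i%:R) (size q))).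
- by apply/allP => t _; rewrite /root q0.
- by rewrite map_inj_uniq ?iota_uniq // => i j /eqP; rewrite eqr_nat => /eqP.
by rewrite size_mkseq.
Qed.

Lemma tri_conjugate T : trilinear_sym idfun T ->
  exists v w, [/\ v != 0, w != 0 & forall x, T v w x = 0].
Proof.
move=> triT.
pose M u : 'M[C]_3 := \matrix_(i, j) T u (delta_mx 0 i) (delta_mx 0 j).
have mulM u w j : (w *m M u) 0 j = T u w (delta_mx 0 j).
  by rewrite mxE sum_ord3 !mxE [in RHS](row3E w) (tri_lin2 triT).
have TM v w : w *m M v = 0 -> forall x, T v w x = 0.
  move=> wM x; rewrite (row3E x) (tri_lin3 triT) /= -!mulM wM !mxE.
  by rewrite !mulr0 !addr0.
have d0 : (delta_mx 0 0 : 'rV[C]_3) != 0.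
  by apply/rV0Pn; exists 0; rewrite mxE eqxx oner_neq0.
have [/eqP/det0P[w w0 wM]|dM] := eqVneq (\det (M (delta_mx 0 0))) 0.
  by exists (delta_mx 0 0), w; split=> //; exact: TM.
(* With [M e0] invertible, an eigenvector w of [M e1 *m invmx (M e0)] for the eigenvalue a is killed
   by [M e1 - a *: M e0], the matrix of the polar at [e1 - a *: e0]. *)
have [//|a] :=
  @eigenvalue_closed C 3 (M (delta_mx 0 1) *m invmx (M (delta_mx 0 0))).
case/eigenvalueP => w wE w0; exists (delta_mx 0 1 - a *: delta_mx 0 0), w.
split=> //.
  apply/rV0Pn; exists 1; rewrite !mxE /= mulr0 subr0 oner_neq0 //.
apply: TM; have -> : M (delta_mx 0 1 - a *: delta_mx 0 0) =
   M (delta_mx 0 1) - a *: M (delta_mx 0 0).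
  apply/matrixP => i j; rewrite !mxE [delta_mx 0 1 - _]addrC -scaleNr.
  by case: triT => _ _ ->; rewrite /= mulNr addrC.
have uM : M (delta_mx 0 0) \in unitmx by rewrite unitmxE unitfE.
move/(congr1 (mulmx^~ (M (delta_mx 0 0)))): wE.
rewrite -mulmxA mulmxKV // mulmxBr -scalemxAl -scalemxAr => ->.
by rewrite subrr.
Qed.

(** The coefficients [a1], [a2], [b1] involve both v and w and vanish. What is left is [a0 a3 c0 c1
    - b0^2 a3 c1 - b2^2 a0 c0 + b0^2 b2^2], which factors. *)
Lemma clebsch_at_conj T v e w : trilinear_sym idfun T ->
  (forall x, T v w x = 0) ->
  clebsch_at T v e w = (T v v v * T v e e - T v v e ^+ 2)
                     * (T w w w * T w e e - T w w e ^+ 2).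
Proof.
move=> triT vw; rewrite /clebsch_at.
have s t : T v t w = 0 by case: triT => _ s _; rewrite s vw.
rewrite !(tri_symE triT v e w) !s.
by rewrite /aronhold; ring.
Qed.

(** The degenerate conjugate pair v = w: now [a2], [a3], [b2] vanish and [(a1 c1 - b1^2)^2] is
    left. *)
Lemma clebsch_at_conj_self T v e e' : trilinear_sym idfun T ->
  (forall x, T v v x = 0) ->
  clebsch_at T e e' v = (T v e e * T v e' e' - T v e e' ^+ 2) ^+ 2.
Proof.
move=> triT vv; rewrite /clebsch_at.
have -> : T e v v = 0 by rewrite (tri_symE triT v e e) vv.
have -> : T e' v v = 0 by rewrite (tri_symE triT v e' e') vv.
rewrite vv.
have -> : T e e v = T v e e by rewrite (tri_symE triT v e e).
have -> : T e e' v = T v e e' by rewrite (tri_symE triT v e e').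
have -> : T e' e' v = T v e' e' by rewrite (tri_symE triT v e' e').
by rewrite /aronhold; ring.
Qed.

(* A quadratic form killed by w is a binary form in the coordinates along
   v and e, so it has rank at most one as soon as its 2x2 determinant is 0. *)
Lemma disc_rank_le1 T p v e w : trilinear_sym idfun T -> spans v e w ->
  (forall x, T p w x = 0) -> T p v v * T p e e = T p v e ^+ 2 ->
  rank_le1 (T p).
Proof.
move=> triT sp pw disc x y.
have [x1 [x2 [x3 ->]]] := sp x; have [y1 [y2 [y3 ->]]] := sp y.
have s t t' : T p t t' = T p t' t by case: triT => _ ->.
rewrite !(tri_lin2 triT) !(tri_lin3 triT) /= !pw (s e v) (s e w) (s v w) !pw.
ring: disc.
Qed.

Lemma cubic_rank_le1 T : trilinear_sym idfun T ->
  (forall x y z, clebsch_at T x y z = 0) ->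
  exists2 v, v != 0 & rank_le1 (T v).
Proof.
move=> triT S0; have [v [w [v0 w0 vw]]] := tri_conjugate triT.
have [[c wE]|[e sp]] := collinear_or_spans w v0.
  have c0 : c != 0 by apply: contraNneq w0 => c0; rewrite wE c0 scale0r.
  have vv x : T v v x = 0.
    (* Zero terms are added to reach the three-term shape of [tri_lin2]. *)
    have := vw x; rewrite wE -[c *: v]addr0 -[c *: v + 0]addr0.
    rewrite -{2}(scale0r v) -{1}(scale0r v) (tri_lin2 triT) /= !mul0r !addr0.
    by move/eqP; rewrite mulf_eq0 (negbTE c0) => /eqP.
  exists v => //; have [e [e' sp']] := spans_last v0.
  apply: (disc_rank_le1 triT sp' vv).
  have /eqP := S0 e e' v; rewrite clebsch_at_conj_self // sqrf_eq0 subr_eq0.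
  by move/eqP.
have wv x : T w v x = 0 by case: triT => s _ _; rewrite s vw.
have sp' : spans w e v.
  move=> x; have [x1 [x2 [x3 ->]]] := sp x; exists x3, x2, x1.
  by apply/rowP=> i; rewrite !mxE; ring.
have /eqP := S0 v e w; rewrite clebsch_at_conj // mulf_eq0 !subr_eq0.
case/orP => /eqP disc; [exists v | exists w] => //.
  exact: (disc_rank_le1 triT sp vw disc).
exact: (disc_rank_le1 triT sp' wv disc).
Qed.

(** For a vector x0 with [T v x0 x0] nonzero, the form l is [T v x0] and c the inverse of its value
    at x0. *)
Lemma rank_le1_square T v : trilinear_sym idfun T -> rank_le1 (T v) ->
  exists c l, lform l /\ forall x y, T v x y = c * (l x * l y).
Proof.
move=> triT r1; have [q0|] := pselect (forall x, T v x x = 0).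
  exists 0, (fun=> 0); split=> [a u w|x y]; first by rewrite mulr0 addr0.
  by apply/eqP; rewrite mul0r -sqrf_eq0 -r1 q0 mul0r.
move/existsNP => [x0 /eqP a0].
have lL : lform (T v x0).
  by case: triT => s1 s2 lin a y z; rewrite !(s2 v x0) !(s1 v) lin.
exists (T v x0 x0)^-1, (T v x0); split=> // y z.
apply: (mulfI a0); rewrite mulVKf //.
(* Polarization: the condition at y + z, minus those at y and z, is twice the mixed identity. *)
have := r1 x0 (1 *: y + 1 *: z + 0 *: z).
rewrite !(tri_lin2 triT) !(tri_lin3 triT) /= !mul0r !addr0 !mul1r.
have := r1 x0 y; have := r1 x0 z; have -> : T v z y = T v y z by case: triT.
move=> Hz Hy; rewrite !mulrDr Hz Hy => H.
apply: (@mulIf _ 2%:R); first by rewrite pnatr_eq0.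
apply: (addrI (T v x0 y ^+ 2 + T v x0 z ^+ 2)).
move/eqP: H; rewrite -subr_eq0 => /eqP H; apply/eqP.
by rewrite -subr_eq0 -[X in _ == X]H; apply/eqP; ring.
Qed.

(** One of the two polynomials is zero. The coefficients retained are those giving a determinant at
    k and at k' along the line [t *: k' + k]. *)
Lemma quadratic_mul_eq0 (a b c a' b' c' : C) :
  (forall t, (a + b * t + c * t ^+ 2) * (a' + b' * t + c' * t ^+ 2) = 0) ->
  a = 0 \/ c' = 0.
Proof.
move=> H; pose P := Poly [:: a; b; c]; pose Q := Poly [:: a'; b'; c'].
have /eqP : P * Q = 0.
  apply: horner_eq0_all => t; rewrite -[RHS](H t) hornerM !horner_Poly /=.
  by ring.
rewrite mulf_eq0 => /orP[] /eqP E.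
  by left; move/(congr1 (coefp 0)): E; rewrite /= coef_Poly coef0.
by right; move/(congr1 (coefp 2)): E; rewrite /= coef_Poly coef0.
Qed.

(** If [T x0 x0 x0] is nonzero then [T x0] is c l^2. For y with l(y) = 0 the polar [T y x0]
    vanishes, and the rank condition for y + x0 forces [T y] to vanish; so T depends on each
    argument through l only. *)
Lemma rank_le1_cube T : trilinear_sym idfun T ->
  (forall x, rank_le1 (T x)) ->
  exists c l, lform l /\ forall x y z, T x y z = c * (l x * l y * l z).
Proof.
move=> triT r1; case: (triT) => s1 s2 lin.
have sq0 y : (forall x, T y x x = 0) -> forall x z, T y x z = 0.
  by move=> H x z; apply/eqP; rewrite -sqrf_eq0 -r1 // H mul0r.
have [H|] := pselect (forall x, T x x x = 0).
  exists 0, (fun=> 0); split=> [a u w|x y z]; first by rewrite mulr0 addr0.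
  rewrite mul0r; apply: sq0 => w; rewrite s1 s2; apply/eqP.
  by rewrite -sqrf_eq0 -r1 H mul0r.
move/existsNP => [x0 /eqP]; have [c [l [lL E]]] := rank_le1_square triT (r1 x0).
rewrite E !mulf_eq0 !negb_or => /and3P[c0 m0 _].
have K0 y : l y = 0 -> forall z w, T y z w = 0.
  move=> ly; apply: sq0 => z; have := r1 (1 *: y + x0) x0 z.
  have yx0 w : T y x0 w = 0 by rewrite s1 E ly mul0r mulr0.
  rewrite !lin !yx0 !E /= => H; have {H} : c * (l x0 * l x0) * T y z z = 0.
    move/eqP: H; rewrite -subr_eq0 => /eqP H.
    by rewrite -[RHS]H; ring.
  by move/eqP; rewrite !mulf_eq0 (negbTE c0) (negbTE m0) => /eqP.
exists (c / l x0), l; split=> // x y z.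
(* Decomposition along x0 and the plane l = 0. *)
have -> : x = (l x / l x0) *: x0 + (- (l x / l x0) *: x0 + x).
  by rewrite scaleNr addNKr.
have ly : l (- (l x / l x0) *: x0 + x) = 0 by rewrite lL; field.
by rewrite lin E K0 //= lL ly; field.
Qed.

(** Exchanging the first two slots, together with the symmetry of each [F k], generates all
    permutations, and carries linearity to the first slot. *)
Definition quadrilinear_sym
    (F : 'rV[C]_3 -> 'rV[C]_3 -> 'rV[C]_3 -> 'rV[C]_3 -> C) : Prop :=
  (forall k, trilinear_sym idfun (F k)) /\
  (forall k p x y, F k p x y = F p k x y).

Section Quartic.
Variable F : 'rV[C]_3 -> 'rV[C]_3 -> 'rV[C]_3 -> 'rV[C]_3 -> C.
Hypothesis quadF : quadrilinear_sym F.
Hypothesis F_clebsch : forall k x y z, clebsch_at (F k) x y z = 0.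

Let triF k : trilinear_sym idfun (F k). Proof. exact: quadF.1. Qed.
Let F12 k p x y : F k p x y = F p k x y. Proof. exact: quadF.2. Qed.
Let F_lin a k k' p x y : F (a *: k + k') p x y = a * F k p x y + F k' p x y.
Proof. by rewrite !(F12 _ p); case: (triF p) => _ _ ->. Qed.

Lemma quartic_disc_line p v e w k k' t :
  F (t *: k' + k) p v v * F (t *: k' + k) p e e - F (t *: k' + k) p v e ^+ 2 =
  (F k p v v * F k p e e - F k p v e ^+ 2)
  + (F k p v v * F k' p e e + F k' p v v * F k p e e
     - 2%:R * F k p v e * F k' p v e) * t
  + (F k' p v v * F k' p e e - F k' p v e ^+ 2) * t ^+ 2.
Proof. by rewrite !F_lin; ring. Qed.

(** The product of the two determinants vanishes on K. A linear space is irreducible: if one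
    determinant is nonzero at k, restriction to the line through k in direction k' shows that the
    other vanishes at k'. *)
Lemma quartic_rank_le1 (K : 'rV[C]_3 -> Prop) p v : p != 0 -> v != 0 ->
  (forall a k k', K k -> K k' -> K (a *: k + k')) ->
  (forall k x, K k -> F k p v x = 0) ->
  (forall k, K k -> rank_le1 (F k p)) \/ (forall k, K k -> rank_le1 (F k v)).
Proof.
move=> p0 v0 K_lin Kpv.
have [[c vE]|[e sp]] := collinear_or_spans v p0.
  have c0 : c != 0 by apply: contraNneq v0 => c0; rewrite vE c0 scale0r.
  have [e [e' sp']] := spans_last p0.
  left=> k Kk; have pp x : F k p p x = 0.
    have := Kpv k x Kk; rewrite vE -[c *: p]addr0 -[c *: p + 0]addr0.
    rewrite -{2}(scale0r p) -{1}(scale0r p) (tri_lin2 (triF k)) /=.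
    rewrite !mul0r !addr0.
    by move/eqP; rewrite mulf_eq0 (negbTE c0) => /eqP.
  apply: (disc_rank_le1 (triF k) sp' pp).
  have /eqP := F_clebsch k e e' p.
  by rewrite clebsch_at_conj_self // sqrf_eq0 subr_eq0 => /eqP.
have sp' : spans v e p.
  move=> x; have [x1 [x2 [x3 ->]]] := sp x; exists x3, x2, x1.
  by apply/rowP=> i; rewrite !mxE; ring.
pose q1 k := F k p p p * F k p e e - F k p p e ^+ 2.
pose q2 k := F k v v v * F k v e e - F k v v e ^+ 2.
have q12 k : K k -> q1 k * q2 k = 0.
  move=> Kk; rewrite /q1 /q2 -(clebsch_at_conj _ (triF k)) // => x.
  exact: Kpv.
have [q10|] := pselect (forall k, K k -> q1 k = 0).
  left=> k Kk; apply: (disc_rank_le1 (triF k) sp) => [x|]; first exact: Kpv.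
  by apply/eqP; rewrite -subr_eq0; apply/eqP/q10.
move/existsNP => [k /not_implyP[Kk q1k]].
right=> k' Kk'; apply: (disc_rank_le1 (triF k') sp') => [x|].
  by case: (triF k') => -> _ _; exact: Kpv.
have [t|//|/eqP] := @quadratic_mul_eq0 (q1 k) 
   (F k p p p * F k' p e e + F k' p p p * F k p e e
     - 2%:R * F k p p e * F k' p p e) (q1 k') (q2 k)
   (F k v v v * F k' v e e + F k' v v v * F k v e e
     - 2%:R * F k v v e * F k' v v e) (q2 k').
  rewrite -(q12 (t *: k' + k)); last exact: K_lin.
  by congr (_ * _); rewrite /q1 /q2 quartic_disc_line.
by rewrite subr_eq0 => /eqP.
Qed.

(* A linear space of quadratic forms of rank at most one has dimension at most
   one, so the plane of all k with l k = 0 contains some k killed by p. *)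
Lemma rank_le1_pencil p (l : 'rV[C]_3 -> C) : lform l ->
  (forall k, l k = 0 -> rank_le1 (F k p)) ->
  exists2 k, k != 0 & forall x y, F k p x y = 0.
Proof.
move=> lL r1.
have K_lin a k k' : l k = 0 -> l k' = 0 -> l (a *: k + k') = 0.
  by move=> lk lk'; rewrite lL lk lk' mulr0 addr0.
have sq0 k : l k = 0 -> (forall x, F k p x x = 0) -> forall x y, F k p x y = 0.
  by move=> lk H x y; apply/eqP; rewrite -sqrf_eq0 -r1 // H mul0r.
have [H|] := pselect (forall k, l k = 0 -> forall x, F k p x x = 0).
  have [k k0 [lk _]] := common_zero lL lL.
  by exists k => //; apply: sq0 => // x; apply: H.
move/existsNP => [k1 /not_implyP[lk1 /existsNP[x1 /eqP nz]]].
(* The vector k2 is chosen in the plane so that its quadric vanishes at x1; comparing the rank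
   conditions for k1 and k2 + k1 at x1, y then makes it vanish at every y. *)
have [|k2 k20 [lk2 z]] := @common_zero _ l (fun k => F k p x1 x1) lL.
  by move=> a u w; rewrite F_lin.
exists k2 => //; apply: (sq0 _ lk2) => y.
have z' : F k2 p x1 y = 0.
  by apply/eqP; rewrite -sqrf_eq0 -r1 // z mul0r.
have := r1 _ (K_lin 1 k2 k1 lk2 lk1) x1 y; rewrite !F_lin z z' !mul1r !add0r.
rewrite -(r1 _ lk1 x1 y) => /(mulfI nz)/eqP.
by rewrite -subr_eq0 addrK => /eqP.
Qed.

Lemma quartic_pole : exists v c l, [/\ v != 0, lform l
  & forall x y z, F v x y z = c * (l x * l y * l z)].
Proof.
have d0 : (delta_mx 0 0 : 'rV[C]_3) != 0.
  by apply/rV0Pn; exists 0; rewrite mxE eqxx oner_neq0.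
set p := delta_mx 0 0 in d0.
have [v v0 r1] := cubic_rank_le1 (triF p) (F_clebsch p).
have [c [l [lL E]]] := rank_le1_square (triF p) r1.
have [p1 [p2 [p10 p20 p12]]] :
    exists p1 p2, [/\ p1 != 0, p2 != 0 & forall x y, F p1 p2 x y = 0].
  have [| |H|H] := @quartic_rank_le1 (fun k => l k = 0) p v d0 v0.
  - by move=> a k k' lk lk'; rewrite lL lk lk' mulr0 addr0.
  - move=> k x lk; rewrite F12; case: (triF p) => -> _ _.
    by rewrite E lk mul0r mulr0.
  - have [k k0 kp] := rank_le1_pencil lL H.
    by exists k, p.
  have [k k0 kv] := rank_le1_pencil lL H.
  by exists k, v.
have [w w0 r1w] : exists2 w, w != 0 & forall x, rank_le1 (F x w).
  have [| |H|H] := @quartic_rank_le1 (fun=> True) p1 p2 p10 p20.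
  - by [].
  - by move=> k x _; rewrite F12; case: (triF p1) => -> _ _; rewrite p12.
  - by exists p1 => // x; apply: H.
  by exists p2 => // x; apply: H.
have [|c' [l' [l'L E']]] := rank_le1_cube (triF w).
  by move=> x y z; rewrite -!(F12 x w); exact: r1w.
by exists w, c', l'.
Qed.

End Quartic.

End RankOne.

(** * Directional derivatives of polynomials *)

Section Derivations.
Variable C : fieldType.
Implicit Types (f g h : {mpoly C[3]}) (u v w : 'rV[C]_3).

(** Chain rule. The identity holds for 1 and the variables and is stable under products, hence holds
    for monomials; linearity does the rest. *)
Lemma mderiv_comp n k (lq : n.-tuple {mpoly C[k]}) (p : {mpoly C[n]}) j :
  mderiv j (p \mPo lq) =
  \sum_(i < n) (mderiv i p \mPo lq) * mderiv j (tnth lq i).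
Proof.
pose P q := mderiv j (q \mPo lq) =
  \sum_(i < n) (mderiv i q \mPo lq) * mderiv j (tnth lq i).
have P1 : P 1.
  rewrite /P comp_mpoly1 -mpolyC1 mderivC big1 // => i _.
  by rewrite mderivC comp_mpoly0 mul0r.
have PM q r : P q -> P r -> P (q * r).
  move=> Pq Pr; rewrite /P rmorphM /= mderivM Pq Pr mulr_suml mulr_sumr.
  rewrite -big_split; apply: eq_bigr => i _ /=.
  by rewrite mderivM comp_mpolyD !rmorphM /= mulrDl mulrAC mulrA.
have PX i : P 'X_i.
  rewrite /P comp_mpolyXU -tnth_nth (bigD1 i) //= big1 => [|l li].
    rewrite mderivX mnm1E eqxx scale1r -{1}[U_(i)%MM]add0m addmK mpolyX0.
    by rewrite comp_mpoly1 mul1r addr0.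
  by rewrite mderivX mnm1E eq_sym (negbTE li) scale0r comp_mpoly0 mul0r.
elim/mpolyind: p => [|c m p _ _ IH].
  rewrite comp_mpoly0 mderiv0 big1 // => i _.
  by rewrite mderiv0 comp_mpoly0 mul0r.
have PXm : P 'X_[m].
  move: (P) P1 PM PX => {}P P1 PM PX.
  rewrite mpolyXE_id; elim/big_ind: _ => // i _.
  by elim: (m i) => [|r IHr]; rewrite ?expr0 // exprS; apply: PM.
rewrite comp_mpolyD comp_mpolyZ mderivD mderivZ PXm IH scaler_sumr -big_split.
apply: eq_bigr => i _ /=.
by rewrite mderivD mderivZ comp_mpolyD comp_mpolyZ mulrDl scalerAl.
Qed.

Definition dirD u f : {mpoly C[3]} := \sum_i u 0 i *: mderiv i f.

Definition linp u : {mpoly C[3]} := \sum_i u 0 i *: 'X_i.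

Lemma dirD_is_linear u : linear (dirD u).
Proof.
move=> a f g; rewrite /dirD scaler_sumr -big_split; apply: eq_bigr => i _ /=.
by rewrite mderivD mderivZ scalerDr !scalerA mulrC.
Qed.

HB.instance Definition _ u :=
  GRing.isLinear.Build C {mpoly C[3]} {mpoly C[3]} _ (dirD u)
    (dirD_is_linear u).

Lemma dirD_linl a u v f : dirD (a *: u + v) f = a *: dirD u f + dirD v f.
Proof.
rewrite /dirD scaler_sumr -big_split; apply: eq_bigr => i _ /=.
by rewrite !mxE scalerDl scalerA.
Qed.

Lemma dirD_delta i f : dirD (delta_mx 0 i) f = mderiv i f.
Proof.
rewrite /dirD (bigD1 i) //= big1 => [|j ji].
  by rewrite mxE !eqxx scale1r addr0.
by rewrite mxE eqxx (negbTE ji) scale0r.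
Qed.

Lemma dirDC u c : dirD u c%:MP = 0.
Proof. by rewrite /dirD big1 // => i _; rewrite mderivC scaler0. Qed.

Lemma dirDM u f g : dirD u (f * g) = dirD u f * g + f * dirD u g.
Proof.
rewrite /dirD mulr_suml mulr_sumr -big_split; apply: eq_bigr => i _ /=.
by rewrite mderivM scalerDr scalerAl scalerAr.
Qed.

Lemma dirD_comm u v f : dirD u (dirD v f) = dirD v (dirD u f).
Proof.
rewrite {2}/dirD linear_sum /= [RHS]/dirD; apply: eq_bigr => i _.
rewrite linearZ /=; congr (_ *: _); rewrite /dirD linear_sum.
by apply: eq_bigr => j _ /=; rewrite mderivZ mderiv_comm.
Qed.

Definition dotr u v : C := \sum_i u 0 i * v 0 i.

Lemma dotr_linl a u v w : dotr (a *: u + v) w = a * dotr u w + dotr v w.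
Proof.
rewrite /dotr mulr_sumr -big_split; apply: eq_bigr => i _ /=.
by rewrite !mxE mulrDl mulrA.
Qed.

Lemma dotrC u v : dotr u v = dotr v u.
Proof. by apply: eq_bigr => i _; rewrite mulrC. Qed.

Lemma linp_lin a u v : linp (a *: u + v) = a *: linp u + linp v.
Proof.
rewrite /linp scaler_sumr -big_split; apply: eq_bigr => i _ /=.
by rewrite !mxE scalerDl scalerA.
Qed.

Lemma dirD_linp u v : dirD u (linp v) = (dotr v u)%:MP.
Proof.
rewrite /linp linear_sum /dotr rmorph_sum; apply: eq_bigr => i _ /=.
rewrite linearZ /= /dirD (bigD1 i) //= big1 => [|j ji].
  rewrite mderivX mnm1E eqxx scale1r -{1}[U_(i)%MM]add0m addmK mpolyX0.
  by rewrite addr0 scalerA -mul_mpolyC mulr1.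
by rewrite mderivX mnm1E eq_sym (negbTE ji) !scale0r scaler0.
Qed.

Lemma dirD_linpX u v n :
  dirD u (linp v ^+ n.+1) = (n.+1%:R * dotr v u) *: linp v ^+ n.
Proof.
elim: n => [|n IH].
  by rewrite expr1 expr0 mul1r dirD_linp -mul_mpolyC mulr1.
rewrite exprS dirDM IH dirD_linp -scalerAr -exprS mul_mpolyC -scalerDl.
by congr (_ *: _); rewrite -[n.+2]addn1 natrD; ring.
Qed.

Lemma linp_homog u : linp u \is 1.-homog.
Proof.
apply: rpred_sum => i _; apply: rpredZ.
by rewrite dhomogX /= mdeg1.
Qed.

Lemma dirD_homog d u f : f \is d.+1.-homog -> dirD u f \is d.-homog.
Proof.
move=> hf; apply: rpred_sum => i _; apply: rpredZ.
apply/dhomogP => m; rewrite mcoeff_msupp mcoeff_mderiv => nz.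
have {nz} : (m + U_(i))%MM \in msupp f.
  by rewrite mcoeff_msupp; apply: contraNneq nz => ->; rewrite mul0rn.
by move/dhomogP: hf => hf /hf /=; rewrite mdegD mdeg1 addn1 => -[].
Qed.

Lemma comp_homog n k d (lq : n.-tuple {mpoly C[k]}) (p : {mpoly C[n]}) :
  (forall i, tnth lq i \is 1.-homog) -> p \is d.-homog ->
  (p \mPo lq) \is d.-homog.
Proof.
move=> hlq /dhomogP hp; rewrite comp_mpolyE big_seq; apply: rpred_sum => m mp.
apply: rpredZ; have /= <- := hp _ mp.
rewrite mdegE; elim/big_ind2: _ => //= [|a b i j ha hb|i _].
- exact: dhomog1.
- exact: dhomogM.
by have := dhomogMn (m i) (hlq i); rewrite mul1n.
Qed.

End Derivations.

(** * Vanishing of the Clebsch covariant on split forms *)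

Lemma aronhold_split (K : comNzRingType) (a0 a3 b0 c0 d0 : K) :
  aronhold a0 0 0 a3 b0 0 0 c0 0 d0 = 0.
Proof. by rewrite /aronhold; ring. Qed.

Section SplitForms.
Variable C : fieldType.
Implicit Types (f g h : {mpoly C[3]}) (u v w : 'rV[C]_3) (A B : 'M[C]_3).

Definition D3 f u v w : {mpoly C[3]} := dirD u (dirD v (dirD w f)).

Lemma trilinear_D3 f : trilinear_sym (@mpolyC 3 C) (D3 f).
Proof.
split=> [u v w|u v w|a u u' v w]; first exact: dirD_comm.
- by congr (dirD u _); exact: dirD_comm.
by rewrite /D3 dirD_linl mul_mpolyC.
Qed.

Lemma v1E : v1 = 0. Proof. by apply/val_inj; rewrite /= inordK. Qed.
Lemma v2E : v2 = 1. Proof. by apply/val_inj; rewrite /= inordK. Qed.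
Lemma v3E : v3 = 2%:R. Proof. by apply/val_inj; rewrite /= inordK. Qed.

Lemma clebschE f :
  clebsch f = clebsch_at (D3 f) (delta_mx 0 0) (delta_mx 0 1) (delta_mx 0 2%:R).
Proof. by rewrite /clebsch_at /D3 !dirD_delta -v3E -v2E -v1E. Qed.

(** Chain rule for g(Ax): the direction u is carried to Au, which for row vectors is [u *m A^T]. *)
Lemma dirD_lin_change u A g :
  dirD u (lin_change A g) = lin_change A (dirD (u *m A^T) g).
Proof.
rewrite [dirD (_ *m _) g]/dirD /lin_change [RHS]linear_sum /= {1}/dirD.
set lq := mktuple _.
transitivity (\sum_j \sum_i
    u 0 j *: ((mderiv i g \mPo lq) * mderiv j (tnth lq i))).
  by apply: eq_bigr => j _; rewrite mderiv_comp scaler_sumr.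
rewrite exchange_big; apply: eq_bigr => i _ /=.
rewrite comp_mpolyZ -mul_mpolyC mulrC mxE.
have -> : (\sum_j u 0 j * A^T j i)%:MP_[3] = dirD u (linp (row i A)).
  rewrite dirD_linp; congr (_%:MP).
  by apply: eq_bigr => j _; rewrite !mxE mulrC.
rewrite /dirD mulr_sumr; apply: eq_bigr => j _ /=.
rewrite -scalerAr tnth_mktuple; congr (_ *: (_ * mderiv j _)).
by apply: eq_bigr => k _; rewrite mxE.
Qed.

Lemma split_form_clebsch d f : split_form d f -> clebsch f = 0.
Proof.
move=> [A [g [uA [[al [c [_ gE]]] ->]]]]; set h := lin_change A g.
have uAT : A^T \in unitmx by rewrite unitmx_tr.
(* Directions which the coordinate change carries to the standard ones. *)
pose b i := delta_mx 0 i *m invmx A^T : 'rV[C]_3.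
have bE i q : dirD (b i) (lin_change A q) = lin_change A (mderiv i q).
  by rewrite dirD_lin_change /b mulmxKV // dirD_delta.
have g3 i : i != v3 -> mderiv i (mderiv v3 g) = 0.
  move=> i3; rewrite gE mderivD mderiv_comp big_ord_recl big_ord1 /= addrC.
  rewrite !(tnth_nth 0) /= !mderivX !mnm1E.
  rewrite v1E v2E v3E /= !scale0r !mulr0 !addr0.
  rewrite !mderivZ mpolyXn mderivX mderivZ mderivX mnmBE !mulmnE !mnm1E.
  by rewrite -v3E eq_sym (negbTE i3) mul0n sub0n scale0r !scaler0.
have D3b i w : i != v3 -> D3 h (b i) (b v3) w = 0.
  move=> i3; rewrite /D3 (dirD_comm (b v3) w) (dirD_comm (b i) w).
  by rewrite !bE g3 // /lin_change comp_mpoly0 linear0.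
have tri := trilinear_D3 h; rewrite clebschE.
apply: (clebsch_at_eq0 tri (u := b v1) (v := b v2) (w := b v3)).
  move=> x; exists ((x *m A^T) 0 0), ((x *m A^T) 0 1), ((x *m A^T) 0 2%:R).
  rewrite -{1}(mulmxK uAT x) {1}(row3E (x *m A^T)) !mulmxDl -!scalemxAl.
  by rewrite v1E v2E v3E.
have n1 : v1 != v3 by rewrite v1E v3E.
have n2 : v2 != v3 by rewrite v2E v3E.
case: (tri) => s1 s2 _; rewrite /clebsch_at.
have -> : D3 h (b v1) (b v1) (b v3) = 0 by rewrite s2 D3b.
have -> : D3 h (b v1) (b v2) (b v3) = 0 by rewrite s2 D3b.
have -> : D3 h (b v2) (b v2) (b v3) = 0 by rewrite s2 D3b.
(* Each monomial of the expression contains a derivative mixing the third direction with another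
   one. *)
by rewrite (D3b v1) // (D3b v2) // aronhold_split.
Qed.

Lemma linp_lin_change A l : lin_change A (linp l) = linp (l *m A).
Proof.
rewrite /lin_change /linp linear_sum /=; set lq := mktuple _.
transitivity (\sum_i \sum_j (l 0 i * A i j) *: ('X_j : {mpoly C[3]})).
  apply: eq_bigr => i _; rewrite comp_mpolyZ comp_mpolyXU -tnth_nth.
  by rewrite tnth_mktuple scaler_sumr; apply: eq_bigr => j _; rewrite scalerA.
rewrite exchange_big; apply: eq_bigr => i _ /=.
by rewrite mxE scaler_suml.
Qed.

Lemma lin_changeM A B f : lin_change A (lin_change B f) = lin_change (B *m A) f.
Proof.
rewrite {2}/lin_change comp_mpolyE {1}/lin_change linear_sum /=.
rewrite /lin_change comp_mpolyE; apply: eq_bigr => m _.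
rewrite comp_mpolyZ rmorph_prod /=; congr (_ *: _); apply: eq_bigr => i _.
rewrite rmorphXn /=; congr (_ ^+ _); rewrite !tnth_mktuple.
have rowL (M : 'M[C]_3) : \sum_j M i j *: 'X_j = linp (row i M).
  by apply: eq_bigr => j _; rewrite mxE.
by rewrite (rowL B) (rowL (B *m A)) row_mul -linp_lin_change.
Qed.

Lemma lin_change1 f : lin_change 1%:M f = f.
Proof.
rewrite /lin_change -[RHS]comp_mpoly_id; congr (_ \mPo _).
apply: eq_from_tnth => i; rewrite !tnth_mktuple (bigD1 i) //= big1 => [|j ji].
  by rewrite mxE eqxx scale1r addr0.
by rewrite mxE eq_sym (negbTE ji) scale0r.
Qed.

End SplitForms.

(** * A sufficient condition for being split *)

Section SplitCriterion.
Variable C : numFieldType.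
Implicit Types (f g h : {mpoly C[3]}) (u v w l : 'rV[C]_3) (A B : 'M[C]_3).

(** The binary form is g with the third variable set to 0. In characteristic 0, a monomial
    containing that variable would survive in the derivative. *)
Lemma binary_form d g : g \is d.-homog -> mderiv v3 g = 0 ->
  exists2 al : {mpoly C[2]}, al \is d.-homog
    & g = al \mPo [tuple 'X_v1; 'X_v2].
Proof.
move=> hg g3; exists (g \mPo [tuple 'X_0; 'X_1; 0]).
  apply: comp_homog => // i; rewrite (tnth_nth 0).
  case: i => [[|[|[|//]]] Hi] /=; last exact: rpred0.
  - by rewrite dhomogX /= mdeg1.
  - by rewrite dhomogX /= mdeg1.
rewrite (comp_mpolyE g) linear_sum /= {1}(mpolyE g) big_seq [RHS]big_seq.
apply: eq_bigr => m; rewrite mcoeff_msupp => gm.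
have m3 : m 2%:R = 0%N.
  apply/eqP; apply: contraNT gm; rewrite -lt0n => m3.
  have mE : (m = (m - U_(v3)) + U_(v3))%MM.
    apply/mnmP => i; rewrite mnmDE mnmBE mnm1E v3E.
    by case: eqVneq => [<-|_]; rewrite ?subn0 ?addn0 // subnK.
  move/(congr1 (mcoeff (m - U_(v3))%MM)): g3.
  rewrite mcoeff0 mcoeff_mderiv -mE => /eqP; rewrite mulrn_eq0 /=.
  by [].
rewrite comp_mpolyZ rmorph_prod /=; congr (_ *: _).
rewrite mpolyXE_id.
have prod3 (K : comNzRingType) (F : 'I_3 -> K) :
    \prod_i F i = F 0 * F 1 * F 2%:R.
  rewrite !big_ord_recl big_ord0 mulr1 mulrA.
  by congr (F _ * F _ * F _); exact/val_inj.
rewrite !prod3 m3 !rmorphXn /= !(tnth_nth 0) /= !expr0.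
by rewrite !comp_mpolyXU /= v1E v2E.
Qed.

(** The coordinates of the standard vectors with respect to u, v, w form a right inverse of the
    matrix with columns u, v, w. *)
Lemma unitmx_spans u v w (B := \matrix_(i, j)
    (if j == 0 then u 0 i else if j == 1 then v 0 i else w 0 i) : 'M[C]_3) :
  spans u v w -> B \in unitmx.
Proof.
move=> sp; have [a aE] := choice sp; have [b bE] := choice aE.
have [c cE] := choice bE.
pose D : 'M[C]_3 := \matrix_(i, j) (if i == 0 then a (delta_mx 0 j)
  else if i == 1 then b (delta_mx 0 j) else c (delta_mx 0 j)).
suff : B *m D = 1%:M by case/mulmx1_unit.
apply/matrixP => i j; rewrite !mxE sum_ord3 !mxE /=.
have /rowP/(_ i) := cE (delta_mx 0 j); rewrite !mxE eqxx /= => ->.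
by rewrite ![_ * (_ 0 i)]mulrC.
Qed.

Lemma split_formI d f l v c : f \is d.-homog -> dirD v f = 0 ->
  dotr l v != 0 -> split_form d (f + c *: linp l ^+ d).
Proof.
move=> hf fv lv; have v0 : v != 0.
  apply: contraNneq lv => ->; rewrite /dotr big1 // => i _.
  by rewrite mxE mulr0.
have [e [e' sp]] := spans_last v0.
have lL : lform (dotr l).
  by move=> a x y; rewrite !(dotrC l) dotr_linl.
(* Projection onto the plane l = 0 along v. In the basis [q e], [q e'], [v'] the form l is the third
   coordinate and f involves only the first two. *)
pose q x := - (dotr l x / dotr l v) *: v + x.
have lq x : dotr l (q x) = 0.
  by rewrite /q lL; field.
pose v' := (dotr l v)^-1 *: v + 0.
have l0 : dotr l 0 = 0.
  by have := lL (-1) 0 0; rewrite scaler0 addr0 mulN1r addNr.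
have lv' : dotr l v' = 1 by rewrite /v' lL l0 addr0 mulVf.
have sp' : spans (q e) (q e') v'.
  move=> x; have [a [b [k ->]]] := sp x.
  exists a, b, (k * dotr l v + a * dotr l e + b * dotr l e').
  by apply/rowP=> i; rewrite /q /v' !mxE; field.
have := unitmx_spans sp'; set B := (X in X \in unitmx) => uB.
exists (invmx B), (lin_change B (f + c *: linp l ^+ d)); split.
  by rewrite unitmx_inv.
split; last by rewrite lin_changeM mulmxV // lin_change1.
have hB : lin_change B f \is d.-homog.
  apply: comp_homog => // i; rewrite tnth_mktuple; apply: rpred_sum => j _.
  by apply: rpredZ; rewrite dhomogX /= mdeg1.
have [|al hal alE] := binary_form hB.
  rewrite -dirD_delta dirD_lin_change.
  have -> : delta_mx 0 v3 *m B^T = v'.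
    by rewrite -rowE; apply/rowP => i; rewrite !mxE v3E.
  by rewrite dirD_linl fv scaler0 add0r /dirD big1
    ?/lin_change ?comp_mpoly0 // => i _; rewrite mxE scale0r.
exists al, c; split => //; rewrite -alE {1}/lin_change comp_mpolyD comp_mpolyZ.
congr (_ + _ *: _); rewrite rmorphXn /=; congr (_ ^+ _).
rewrite -/(lin_change B (linp l)) linp_lin_change.
have -> : l *m B = delta_mx 0 v3.
  apply/rowP; apply: ord3P; rewrite !mxE v3E /=.
  - by rewrite -[RHS](lq e); apply: eq_bigr => i _; rewrite !mxE.
  - by rewrite -[RHS](lq e'); apply: eq_bigr => i _; rewrite !mxE.
  by rewrite -[RHS]lv'; apply: eq_bigr => i _; rewrite !mxE.
rewrite /linp (bigD1 v3) //= big1 => [|j j3].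
  by rewrite mxE !eqxx scale1r addr0.
by rewrite mxE (negbTE j3) scale0r.
Qed.

End SplitCriterion.

(** * Continuity of the Clebsch covariant *)

Section Continuity.
Variables (C : numFieldType) (n : nat).
Implicit Types (f g p q : {mpoly C[n]}) (P Q : {mpoly C[n]} -> {mpoly C[n]}).

(** Lipschitz continuity at f for each coefficient separately; the restriction [eps <= 1] makes the
    notion stable under products. *)
Definition coef_lipschitz f P := forall m, exists2 K, 0 <= K &
  forall eps g, 0 < eps -> eps <= 1 ->
    (forall m', `|f@_m' - g@_m'| < eps) -> `|(P f)@_m - (P g)@_m| <= K * eps.

Lemma coef_lipschitz_id f : coef_lipschitz f id.
Proof. by move=> m; exists 1 => // eps g _ _ H; rewrite mul1r ltW. Qed.

Lemma coef_lipschitz_cst f p : coef_lipschitz f (fun=> p).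
Proof. by move=> m; exists 0 => // eps g _ _ _; rewrite subrr normr0 mul0r. Qed.

Lemma coef_lipschitzN f P :
  coef_lipschitz f P -> coef_lipschitz f (fun g => - P g).
Proof.
move=> HP m; have [K K0 HK] := HP m; exists K => // eps g e0 e1 H.
by rewrite !mcoeffN -opprD normrN; exact: HK.
Qed.

Lemma coef_lipschitzD f P Q : coef_lipschitz f P -> coef_lipschitz f Q ->
  coef_lipschitz f (fun g => P g + Q g).
Proof.
move=> HP HQ m; have [K K0 HK] := HP m; have [L L0 HL] := HQ m.
exists (K + L) => [|eps g e0 e1 H]; first exact: addr_ge0.
rewrite !mcoeffD opprD addrACA mulrDl (le_trans (ler_normD _ _)) //.
by apply: lerD; [exact: HK | exact: HL].
Qed.

Lemma coef_lipschitz_mderiv f P i :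
  coef_lipschitz f P -> coef_lipschitz f (fun g => mderiv i (P g)).
Proof.
move=> HP m; have [K K0 HK] := HP (m + U_(i))%MM.
exists (K *+ (m i).+1) => [|eps g e0 e1 H]; first exact: mulrn_wge0.
rewrite !mcoeff_mderiv -mulrnBl normrMn mulrnAl lerMn2r /=.
exact: HK.
Qed.

Lemma coef_lipschitzM f P Q : coef_lipschitz f P -> coef_lipschitz f Q ->
  coef_lipschitz f (fun g => P g * Q g).
Proof.
move=> HP HQ m.
have ex S : coef_lipschitz f S -> forall m, exists K, 0 <= K /\
    forall eps g, 0 < eps -> eps <= 1 -> (forall m', `|f@_m' - g@_m'| < eps) ->
    `|(S f)@_m - (S g)@_m| <= K * eps.
  by move=> HS m'; have [K K0 HK] := HS m'; exists K.
have [K HK] := choice (ex P HP); have [L HL] := choice (ex Q HQ).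
(* Bounds [a b - a' b' = a (b - b') + (a - a') b'], where [b'] has norm at most that of b plus L, as
   eps is at most 1. *)
pose B (k1 k2 : 'X_{1..n}) :=
  `|(P f)@_k1| * L k2 + K k1 * (`|(Q f)@_k2| + L k2).
exists (\sum_(k : 'X_{1..n < (mdeg m).+1, (mdeg m).+1} | m == (k.1 + k.2)%MM)
          B k.1 k.2).
  apply: sumr_ge0 => k _; have [K0 _] := HK k.1; have [L0 _] := HL k.2.
  by rewrite addr_ge0 ?mulr_ge0 ?addr_ge0.
move=> eps g e0 e1 H; rewrite !mcoeffM -sumrB mulr_suml.
apply: le_trans (ler_norm_sum _ _ _) _; apply: ler_sum => k _.
have [K0 /(_ eps g e0 e1 H) HKk] := HK k.1.
have [L0 /(_ eps g e0 e1 H) HLk] := HL k.2.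
move: HKk HLk; rewrite /B; move: ((P f)@_k.1) ((P g)@_k.1) => a a'.
move: ((Q f)@_k.2) ((Q g)@_k.2) => b b' Ha Hb.
have -> : a * b - a' * b' = a * (b - b') + (a - a') * b' by ring.
rewrite [leRHS]mulrDl (le_trans (ler_normD _ _)) // !normrM.
apply: lerD; first by rewrite -mulrA ler_wpM2l ?normr_ge0.
rewrite mulrAC; apply: ler_pM => //.
have -> : b' = b - (b - b') by ring.
apply: le_trans (ler_normB _ _) _; rewrite lerD2l (le_trans Hb) //.
by rewrite ler_piMr.
Qed.

Lemma coef_lipschitz_eq0 f P : coef_lipschitz f P ->
  (forall eps, 0 < eps -> exists2 g, P g = 0 &
     forall m, `|f@_m - g@_m| < eps) -> P f = 0.
Proof.
move=> HP H; apply/mpolyP => m; rewrite mcoeff0; apply/eqP.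
apply/negPn/negP => nz; have [K K0 HK] := HP m.
have r0 : 0 < `|(P f)@_m| by rewrite normr_gt0.
set r := `|(P f)@_m| in r0.
have s0 : 0 < r + K + 1 by rewrite ltr_wpDl ?addr_ge0 // ltW.
(* This tolerance is at most 1 and its product with K is less than r. *)
have e0 : 0 < r / (r + K + 1) by rewrite divr_gt0.
have [g Pg fg] := H _ e0.
have := HK _ g e0 _ fg; rewrite Pg mcoeff0 subr0 -/r => /(_ _) Hr.
have : r <= K * (r / (r + K + 1)).
  by apply: Hr; rewrite ler_pdivrMr // mul1r -addrA lerDl addr_ge0.
rewrite mulrA ler_pdivlMr // mulrC ler_pM2r // => le_rK.
have : K < r + K + 1 by rewrite addrAC -[X in X < _]add0r ltrD2r addr_gt0.
by move=> /lt_le_trans/(_ le_rK); rewrite ltxx.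
Qed.

End Continuity.

Ltac coef_lipschitz_arith :=
  lazymatch goal with
  | |- coef_lipschitz ?f (fun g => @?P g + @?Q g) =>
      apply: (@coef_lipschitzD _ _ f P Q); coef_lipschitz_arith
  | |- coef_lipschitz ?f (fun g => - @?P g) =>
      apply: (@coef_lipschitzN _ _ f P); coef_lipschitz_arith
  | |- coef_lipschitz ?f (fun g => @?P g ^+ 2) =>
      apply: (@coef_lipschitzM _ _ f P P); coef_lipschitz_arith
  | |- coef_lipschitz ?f (fun g => @?P g * @?Q g) =>
      apply: (@coef_lipschitzM _ _ f P Q); coef_lipschitz_arith
  | |- coef_lipschitz ?f (fun g => mderiv ?i (@?P g)) =>
      apply: (@coef_lipschitz_mderiv _ _ f P i); coef_lipschitz_arith
  | |- coef_lipschitz ?f (fun g => g) => exact: coef_lipschitz_id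
  | |- _ => exact: coef_lipschitz_cst
  end.

Lemma clebsch_lipschitz (C : numFieldType) (f : {mpoly C[3]}) :
  coef_lipschitz f (@clebsch C).
Proof. by rewrite /clebsch /d3 /=; coef_lipschitz_arith. Qed.

Lemma rmorph_aronhold (K L : comNzRingType) (phi : {rmorphism K -> L})
    (a0 a1 a2 a3 b0 b1 b2 c0 c1 d0 : K) :
  phi (aronhold a0 a1 a2 a3 b0 b1 b2 c0 c1 d0) =
  aronhold (phi a0) (phi a1) (phi a2) (phi a3) (phi b0) (phi b1) (phi b2)
           (phi c0) (phi c1) (phi d0).
Proof.
by rewrite /aronhold; ring.
Qed.

(** * Polars that are powers of linear forms *)

Section Homogeneous.
Variable C : numFieldType.
Implicit Types (f g h p : {mpoly C[3]}) (u v w l k : 'rV[C]_3).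

Lemma dhomog0P p : p \is 0.-homog -> p = (p@_0%MM)%:MP.
Proof.
move=> hp; apply/mpolyP => m; rewrite mcoeffC.
have [->|m0] := eqVneq m 0%MM; first by rewrite mulr1.
by rewrite mulr0 (dhomog_nemf_coeff hp) //= mdeg_eq0.
Qed.

(** In characteristic 0 a nonzero coefficient in positive degree shows up in some partial
    derivative. Identities of forms can thus be checked by differentiating down to constants. *)
Lemma dhomog_dirD_eq d g h : g \is d.+1.-homog -> h \is d.+1.-homog ->
  (forall u, dirD u g = dirD u h) -> g = h.
Proof.
move=> hg hh E; apply/eqP; rewrite -subr_eq0; apply/eqP/mpolyP => m.
rewrite mcoeff0; have hp : g - h \is d.+1.-homog by rewrite rpredB.
have [md|md] := eqVneq (mdeg m) d.+1; last by rewrite (dhomog_nemf_coeff hp).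
have [i mi] : exists i, (0 < m i)%N.
  apply/existsP; apply: contraPT md => /existsPn H.
  by rewrite mdegE big1 // => i _; apply/eqP; rewrite -leqn0 leqNgt H.
have mE : (m = (m - U_(i)) + U_(i))%MM.
  apply/mnmP => j; rewrite mnmDE mnmBE mnm1E.
  by case: eqVneq => [<-|_]; rewrite ?subn0 ?addn0 // subnK.
have : mderiv i (g - h) = 0 by rewrite -dirD_delta linearB /= E subrr.
move/(congr1 (mcoeff (m - U_(i))%MM)); rewrite mcoeff0 mcoeff_mderiv -mE.
by move/eqP; rewrite mulrn_eq0 /= => /eqP.
Qed.

Lemma linear_form p : p \is 1.-homog -> exists l, p = linp l.
Proof.
move=> hp; exists (\row_i (mderiv i p)@_0%MM).
apply: (dhomog_dirD_eq hp (linp_homog _)) => u.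
rewrite dirD_linp [LHS]dhomog0P ?dirD_homog //; congr (_%:MP).
rewrite /dirD linear_sum; apply: eq_bigr => i _ /=.
by rewrite mcoeffZ mxE mulrC.
Qed.

Lemma meval_linp l k : (linp l).@[fun i => k 0 i] = dotr l k.
Proof.
by rewrite /linp linear_sum; apply: eq_bigr => i _ /=; rewrite mevalZ mevalXU.
Qed.

Lemma dirD_meval k p : p \is 1.-homog -> dirD k p = (p.@[fun i => k 0 i])%:MP.
Proof. by case/linear_form => l ->; rewrite dirD_linp meval_linp. Qed.

Lemma dirD_linp_exp u l d :
  dirD u (linp l ^+ d) = (d%:R * dotr l u) *: linp l ^+ d.-1.
Proof.
case: d => [|d]; last exact: dirD_linpX.
by rewrite expr0 -mpolyC1 dirDC mul0r scale0r.
Qed.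

Lemma linpX_homog l d : linp l ^+ d \is d.-homog.
Proof. by have := dhomogMn d (linp_homog l); rewrite mul1n. Qed.

(** For a quartic this is the fourth polar, symmetric in k as well; for a cubic it does not depend
    on k. *)
Definition D3_at f k u v w : C := (D3 f u v w).@[fun i => k 0 i].

Lemma trilinear_D3_at f k : trilinear_sym idfun (D3_at f k).
Proof.
have [s1 s2 lin] := trilinear_D3 f.
split=> [u v w|u v w|a u u' v w]; rewrite /D3_at.
- by rewrite s1.
- by rewrite s2.
by rewrite lin mevalD mevalM mevalC.
Qed.

Lemma clebsch_D3_at f k x y z :
  clebsch f = 0 -> clebsch_at (D3_at f k) x y z = 0.
Proof.
rewrite clebschE => S0.
have := clebsch_at_eq0 (trilinear_D3 f) (@spans_delta C) S0 x y z.
move/(congr1 (meval (fun i => k 0 i))).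
by rewrite /clebsch_at rmorph_aronhold /= meval0.
Qed.

Lemma lform_dotr (l : 'rV[C]_3 -> C) : lform l ->
  exists r, forall x, l x = dotr r x.
Proof.
move=> lL; exists (\row_i l (delta_mx 0 i)) => x.
by rewrite lform_delta // /dotr sum_ord3 !mxE; congr (_ + _ + _); rewrite mulrC.
Qed.

End Homogeneous.

Section Poles.
Variable C : numClosedFieldType.
Implicit Types (f : {mpoly C[3]}) (v l : 'rV[C]_3).

(** The factor [d%:R] comes from differentiating a d-th power; it makes the right side 0 when d = 0,
    where [d.-1] is 0 too. *)
Definition has_pole d f := exists v l c,
  v != 0 /\ dirD v f = (d%:R * c) *: linp l ^+ d.-1.

Lemma has_pole_low d f : (d <= 2)%N -> f \is d.-homog -> has_pole d f.
Proof.
have d0 : (delta_mx 0 0 : 'rV[C]_3) != 0.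
  by apply/rV0Pn; exists 0; rewrite mxE eqxx oner_neq0.
case: d => [|[|[|//]]] _ hf.
- exists (delta_mx 0 0), 0, 0; split=> //.
  by rewrite (dhomog0P hf) dirDC mul0r scale0r.
- exists (delta_mx 0 0), 0, (dirD (delta_mx 0 0) f)@_0%MM; split=> //.
  by rewrite {1}[LHS]dhomog0P ?dirD_homog // expr0 mul1r -mul_mpolyC mulr1.
have [l lE] := linear_form (dirD_homog (delta_mx 0 0) hf).
exists (delta_mx 0 0), l, 2%:R^-1; split=> //.
by rewrite lE mulfV ?pnatr_eq0 // scale1r.
Qed.

Lemma has_pole_cubic f : f \is 3.-homog -> clebsch f = 0 -> has_pole 3 f.
Proof.
move=> hf S0; have tri := trilinear_D3_at f 0.
have [v v0 r1] := cubic_rank_le1 tri (fun x y z => clebsch_D3_at 0 x y z S0).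
have [c [m [/lform_dotr[l ml] E]]] := rank_le1_square tri r1.
(* Two further derivatives of 3 l^2 produce the factor 6. *)
exists v, l, (c / 6%:R); split=> //.
apply: (@dhomog_dirD_eq _ 1); rewrite ?dirD_homog ?rpredZ ?linpX_homog // => x.
rewrite linearZ /= dirD_linp_exp scalerA.
apply: (@dhomog_dirD_eq _ 0); rewrite ?dirD_homog ?rpredZ ?linpX_homog // => y.
rewrite linearZ /= dirD_linp_exp scalerA expr0 (dirD_comm x) (dirD_comm y).
have h0 : D3 f v y x \is 0.-homog by rewrite /D3 !dirD_homog.
rewrite -/(D3 f v y x) -mul_mpolyC mulr1 (dhomog0P h0); congr (_%:MP).
have := E y x; rewrite /D3_at (dhomog0P h0) mevalC mpolyCK => ->.
by rewrite !ml; field.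
Qed.

Lemma has_pole_quartic f : f \is 4.-homog -> clebsch f = 0 -> has_pole 4 f.
Proof.
move=> hf S0.
have h1 u v w : D3 f u v w \is 1.-homog by rewrite /D3 !dirD_homog.
have quad : quadrilinear_sym (D3_at f).
  split=> [k|k p x y]; first exact: trilinear_D3_at.
  (* Third derivatives of a quartic are linear, so evaluation at k is one more derivative along k,
     and derivatives commute. *)
  rewrite /D3_at; apply: (can_inj (@mpolyCK 3 C)).
  by rewrite -!dirD_meval // /D3 dirD_comm.
have [v [c [m [v0 /lform_dotr[l ml] E]]]] :=
  quartic_pole quad (fun k x y z => clebsch_D3_at k x y z S0).
(* Three further derivatives of 4 l^3 produce the factor 24. *)
exists v, l, (c / 24%:R); split=> //.
apply: (@dhomog_dirD_eq _ 2); rewrite ?dirD_homog ?rpredZ ?linpX_homog // => x.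
rewrite linearZ /= dirD_linp_exp scalerA.
apply: (@dhomog_dirD_eq _ 1); rewrite ?dirD_homog ?rpredZ ?linpX_homog // => y.
rewrite linearZ /= dirD_linp_exp scalerA.
apply: (@dhomog_dirD_eq _ 0); rewrite ?dirD_homog ?rpredZ ?linpX_homog // => z.
rewrite linearZ /= dirD_linp_exp scalerA expr0.
rewrite (dirD_comm x) (dirD_comm y) (dirD_comm z) -/(D3 f z y x).
rewrite dirD_meval // -/(D3_at f v z y x) E -mul_mpolyC mulr1; congr (_%:MP).
by rewrite !ml; field.
Qed.

End Poles.

(** * Approximation by split forms *)

Section Closure.
Variable C : numFieldType.
Implicit Types (p q : {mpoly C[3]}).

(** Binomial expansion in t with the orders 0 and 1 separated; the remainder is t^2 times a
    polynomial in t, bounded for t in the unit disc. *)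
Lemma exprD_order2 (p q : {mpoly C[3]}) d (t : C) :
  (t *: p + q) ^+ d = q ^+ d + (d%:R * t) *: (p * q ^+ d.-1)
  + t ^+ 2 *: \sum_(j < d.-1)
      t ^+ j *: ((q ^+ (d - j.+2) * p ^+ j.+2) *+ 'C(d, j.+2)).
Proof.
rewrite addrC exprDn; case: d => [|[|d]] /=.
- by rewrite big_ord1 big_ord0 !expr0 mul0r scale0r scaler0 !addr0 mulr1.
- rewrite 2!big_ord_recl !big_ord0 /= !expr0 !expr1 scaler0 mul1r !addr0.
  by rewrite !mulr1 mul1r.
rewrite 2!big_ord_recl /= !expr0 expr1 mulr1 subn0 subn1 /= bin0 bin1 addrA.
congr (_ + _ + _).
  by rewrite -scalerAr -scaler_nat scalerA mulrC [p * _]mulrC.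
rewrite scaler_sumr; apply: eq_bigr => j _ /=.
by rewrite exprZn -scalerAr scalerA -exprD add2n scalerMnr.
Qed.

Lemma mcoeff_bound p : exists2 B, 0 <= B & forall m, `|p@_m| <= B.
Proof.
exists (\sum_(m <- msupp p) `|p@_m|); first exact: sumr_ge0.
move=> m; have [mp|] := boolP (m \in msupp p).
  by rewrite (bigD1_seq m) //= lerDl sumr_ge0.
by rewrite -mcoeff_eq0 => /eqP ->; rewrite normr0 sumr_ge0.
Qed.

Lemma mcoeff_pencil_bound n (Q : nat -> {mpoly C[3]}) : exists2 B, 0 <= B &
  forall t m, `|t| <= 1 -> `|(\sum_(j < n) t ^+ j *: Q j)@_m| <= B.
Proof.
have ex j : exists B, 0 <= B /\ forall m, `|(Q j)@_m| <= B.
  by have [B B0 HB] := mcoeff_bound (Q j); exists B.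
have [B HB] := choice ex.
exists (\sum_(j < n) B j); first by apply: sumr_ge0 => j _; case: (HB j).
move=> t m t1; rewrite linear_sum /=; apply: le_trans (ler_norm_sum _ _ _) _.
apply: ler_sum => j _; rewrite mcoeffZ normrM normrX -[B j]mul1r.
have [_ HBj] := HB j.
by apply: ler_pM; rewrite ?exprn_ge0 ?normr_ge0 ?exprn_ile1 ?HBj ?normr_ge0.
Qed.

End Closure.

Lemma pole_in_closure (R : realType) d (f : {mpoly R[i][3]}) :
  f \is d.-homog -> has_pole d f -> in_split_closure d f.
Proof.
move=> hf [v [l [c [v0 fE]]]] eps eps0.
have [lv|lv] := eqVneq (dotr l v) 0; last first.
  exists f; split=> [|m]; last by rewrite subrr normr0 ltcR.
  (* Subtracting this multiple of l^d cancels the derivative along v. *)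
  have h0 : f - (c / dotr l v) *: linp l ^+ d \is d.-homog.
    by rewrite rpredB ?rpredZ ?linpX_homog.
  have D0 : dirD v (f - (c / dotr l v) *: linp l ^+ d) = 0.
    rewrite linearB linearZ /= fE dirD_linp_exp scalerA -scalerBl.
    by rewrite (_ : _ - _ = 0) ?scale0r //; field.
  by have := split_formI (c / dotr l v) h0 D0 lv; rewrite subrK.
have [i vi] : exists i, v 0 i != 0 by exact/rV0Pn.
(* A linear form with value 1 at v. *)
pose z : 'rV[R[i]]_3 := (v 0 i)^-1 *: delta_mx 0 i.
have zv : dotr z v = 1.
  rewrite /dotr (bigD1 i) //= big1 => [|j ji]; rewrite !mxE !eqxx /=.
    by rewrite addr0 mulr1 mulVf.
  by rewrite (negbTE ji) mulr0 mul0r.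
pose Q j := (linp l ^+ (d - j.+2) * linp z ^+ j.+2) *+ 'C(d, j.+2).
have [B B0 HB] := mcoeff_pencil_bound d.-1 Q.
pose E := (eps%:C)%C; have E0 : 0 < E by rewrite ltcR.
have s0 : 0 < 1 + `|c| * B + E by rewrite ltr_wpDl ?addr_ge0 ?mulr_ge0.
(* Small enough that t is at most 1 and the error, bounded by |c| t B, is below E. *)
pose t := E / (1 + `|c| * B + E).
have t0 : 0 < t by rewrite divr_gt0.
have t1 : `|t| <= 1.
  (* The denominator of t exceeds E. *)
  by rewrite gtr0_norm // ler_pdivrMr // mul1r lerDr addr_ge0 ?mulr_ge0.
pose a := f - (d%:R * c) *: (linp z * linp l ^+ d.-1) - (c / t) *: linp l ^+ d.
have hz : (d%:R * c) *: (linp z * linp l ^+ d.-1) \is d.-homog.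
  (* For d = 0 the product would have degree 1, but its scalar is 0. *)
  case: (d) => [|d']; first by rewrite mul0r scale0r rpred0.
  rewrite rpredZ //; exact: dhomogM (linp_homog z) (linpX_homog l d').
have ha : a \is d.-homog.
  by apply: rpredB; [exact: rpredB | rewrite rpredZ ?linpX_homog].
have Da : dirD v a = 0.
  rewrite /a !linearB !linearZ /= fE dirDM dirD_linp !dirD_linp_exp zv lv.
  rewrite !mulr0 !scale0r mulr0 mpolyC1 mul1r addr0 !scalerN scaler0.
  by rewrite subr0 subrr.
have tv : dotr (t *: z + l) v != 0.
  by rewrite dotr_linl zv lv mulr1 addr0 gt_eqF.
exists (a + (c / t) *: linp (t *: z + l) ^+ d); split.
  exact: (split_formI _ ha Da tv).
move=> m; rewrite linp_lin exprD_order2 -mcoeffB.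
set S := \sum_(j < _) _.
have -> : f - (a + (c / t) *: (linp l ^+ d +
    (d%:R * t) *: (linp z * linp l ^+ d.-1) + t ^+ 2 *: S)) = - (c * t) *: S.
  rewrite /a !scalerDr !scalerA.
  have -> : c / t * (d%:R * t) = d%:R * c by field; rewrite gt_eqF.
  have -> : c / t * t ^+ 2 = c * t by field; rewrite gt_eqF.
  by rewrite scaleNr !opprD !opprK; ring.
rewrite mcoeffZ normrM normrN normrM (gtr0_norm t0).
apply: le_lt_trans (_ : `|c| * t * B < _).
  by apply: ler_wpM2l; [rewrite mulr_ge0 // ltW | exact: HB].
rewrite mulrAC /t mulrA ltr_pdivrMr // mulrC ltr_pM2l //.
by rewrite -addrA addrCA ltrDl addr_gt0.
Qed.

Theorem theorem8p1 (R : realType) (d : nat) (f : {mpoly R[i][3]}) :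
  (d <= 4)%N -> f \is d.-homog ->
  (clebsch f = 0 <-> in_split_closure d f).
Proof.
move=> d4 hf; split=> [S0|cl].
  apply: pole_in_closure => //; have [d2|] := leqP d 2.
    exact: has_pole_low.
  case: d d4 hf => [|[|[|[|[|//]]]]] // _ hf _.
    exact: has_pole_cubic.
  exact: has_pole_quartic.
apply: (coef_lipschitz_eq0 (@clebsch_lipschitz _ f)) => eps eps0.
(* A positive element of the complex field is real, so the complex tolerance matches the real one of
   the closure. *)
have epsE : ((complex.Re eps)%:C)%C = eps by rewrite RRe_real // gtr0_real.
have [|g [gs fg]] := cl (complex.Re eps); first by rewrite -ltcR epsE.
exists g; first exact: split_form_clebsch gs.
by move=> m; rewrite -epsE; exact: fg.
Qed.
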